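(* Let $p\ge 2$, let $\alpha_1,\dots,\alpha_p,\beta>-1$ be real numbers with $\alpha_i-\alpha_j\notin\mathbb Z$ for $i\ne j$, and let $\vec n=(n_1,\dots,n_p)\in\mathbb N_0^p$ with $|\vec n|=n_1+\cdots+n_p\ge 1$. Then the type I Jacobi--Piñeiro multiple orthogonal polynomials $P^{(1)}_{\vec n},\dots,P^{(p)}_{\vec n}$, i.e. the polynomials with $\deg P^{(i)}_{\vec n}\le n_i-1$ satisfying $$\sum_{i=1}^p\int_0^1 x^j P^{(i)}_{\vec n}(x)\,x^{\alpha_i}(1-x)^\beta\,dx=\begin{cases}0,& j\in\{0,\dots,|\vec n|-2\},\\ 1,& j=|\vec n|-1,\end{cases}$$ are given, for $i\in\{1,\dots,p\}$, by $$P^{(i)}_{\vec n}(x)=(-1)^{|\vec n|-1}\frac{\prod_{k=1}^p(\alpha_k+\beta+|\vec n|)_{n_k}}{(n_i-1)!\prod_{k=1,\,k\ne i}^p(\alpha_k-\alpha_i)_{n_k}}\cdot\frac{\Gamma(\alpha_i+\beta+|\vec n|)}{\Gamma(\beta+|\vec n|)\,\Gamma(\alpha_i+1)}\;{}_{p+1}F_p\!\left[\begin{matrix}-n_i+1,\ \alpha_i+\beta+|\vec n|,\ (\alpha_i+1-\alpha_k-n_k)_{k\ne i}\\ \alpha_i+1,\ (\alpha_i+1-\alpha_k)_{k\ne i}\end{matrix};x\right].$$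
   Context: $\mathbb N_0=\{0,1,2,\dots\}$. The Pochhammer symbol is $(x)_0=1$, $(x)_n=x(x+1)\cdots(x+n-1)$ for $n\ge1$. The generalized hypergeometric series is ${}_rF_s\left[\begin{matrix}a_1,\dots,a_r\\ c_1,\dots,c_s\end{matrix};x\right]=\sum_{l=0}^\infty\frac{(a_1)_l\cdots(a_r)_l}{(c_1)_l\cdots(c_s)_l}\frac{x^l}{l!}$. In the ${}_{p+1}F_p$ above, the entry $(\alpha_i+1-\alpha_k-n_k)_{k\ne i}$ denotes the list of the $p-1$ parameters $\alpha_i+1-\alpha_k-n_k$, $k\in\{1,\dots,p\}\setminus\{i\}$ (not a Pochhammer symbol), and similarly $(\alpha_i+1-\alpha_k)_{k\ne i}$. For $n_i\ge1$ the series terminates and is a polynomial of degree at most $n_i-1$. A polynomial of degree $\le -1$ is the zero polynomial; when $n_i=0$ the factor $1/(n_i-1)!$ is read as $0$, so that $P^{(i)}_{\vec n}=0$. The product $(\alpha_i+\beta+|\vec n|)_{n_i}\,\Gamma(\alpha_i+\beta+|\vec n|)$ appearing in the formula is understood as $\Gamma(\alpha_i+\beta+|\vec n|+n_i)$ (this matters only if $|\vec n|=1$ and $\alpha_i+\beta=-1$). Under the stated conditions on $\alpha_1,\dots,\alpha_p,\beta$, the weights $x^{\alpha_1},\dots,x^{\alpha_p}$ with the measure $(1-x)^\beta dx$ on $[0,1]$ form an AT system, so the type I polynomials exist and are uniquely determined by the degree and orthogonality conditions. *)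

(* Defs.v *)
From HB Require Import structures.
From mathcomp Require Import all_boot all_order all_algebra.
From mathcomp Require Import all_classical all_reals all_analysis.

Set Implicit Arguments.
Unset Strict Implicit.
Unset Printing Implicit Defensive.

Import Order.TTheory GRing.Theory Num.Theory.
Import numFieldNormedType.Exports.

Local Open Scope classical_set_scope.
Local Open Scope ring_scope.

Section Defs.
Context {R : realType}.

Definition poch (x : R) (m : nat) : R := \prod_(k < m) (x + k%:R).

(* Euler's integral: this is the Gamma function for arguments [0 < x] only. *)
Definition Gamma (x : R) : R :=
  \int[lebesgue_measure]_(t in `[0%R, +oo[) (t `^ (x - 1) * expR (- t)).

(* [a] and [c] list the upper and lower parameters.  The value is the limit of
   the partial sums; it is meaningful only when that limit exists, for instance
   when the series terminates. *)
Definition hypergeom (a c : seq R) (x : R) : R :=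
  limn (series (fun l : nat =>
    (\prod_(t <- a) poch t l) / (\prod_(t <- c) poch t l) *
    (x ^+ l / (l`!)%:R))).

(* [1 / (m - 1)!], read as [0] when [m = 0]. *)
Definition inv_fact_pred (m : nat) : R :=
  if m is m'.+1 then ((m'`!)%:R)^-1 else 0.

Section Multi.
Variables (p : nat) (alpha : 'I_p -> R) (beta : R) (n : 'I_p -> nat).

Definition msize : nat := (\sum_(i < p) n i)%N.

(* [\int_0^1 x^j q(x) x^a (1 - x)^beta dx], with values in [\bar R].  The
   conventional values of [`^] at base 0 occur only at the two endpoints, a
   null set. *)
Definition jacobi_moment (a : R) (q : {poly R}) (j : nat) : \bar R :=
  (\int[lebesgue_measure]_(x in `[0%R, 1%R])
     (x ^+ j * q.[x] * (x `^ a * (1 - x) `^ beta))%:E)%E.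

(* As [size q] is the degree plus one, and [size 0 = 0], [size q <= m] says
   that [q] has degree at most [m - 1]. *)
Definition is_typeI (P : 'I_p -> {poly R}) : Prop :=
  [/\ forall i, (size (P i) <= n i)%N,
      forall j : nat, (j.+1 < msize)%N ->
        (\sum_(i < p) jacobi_moment (alpha i) (P i) j)%E = 0%E
    & (\sum_(i < p) jacobi_moment (alpha i) (P i) msize.-1)%E = 1%E].

Definition typeI_upper (i : 'I_p) : seq R :=
  [:: 1 - (n i)%:R, alpha i + beta + msize%:R &
      [seq alpha i + 1 - alpha k - (n k)%:R | k <- enum 'I_p & k != i]].

Definition typeI_lower (i : 'I_p) : seq R :=
  alpha i + 1 :: [seq alpha i + 1 - alpha k | k <- enum 'I_p & k != i].

(* The factor [k = i] of [\prod_k (alpha_k + beta + |n|)_{n_k}] is merged with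
   [Gamma (alpha_i + beta + |n|)] into [Gamma (alpha_i + beta + |n| + n_i)],
   whose argument is positive as soon as [alpha_i, beta > -1], [0 < n_i]. *)
Definition typeI_coef (i : 'I_p) : R :=
  (-1) ^+ msize.-1 *
  ((\prod_(k < p | k != i) poch (alpha k + beta + msize%:R) (n k)) *
   inv_fact_pred (n i) /
   \prod_(k < p | k != i) poch (alpha k - alpha i) (n k)) *
  (Gamma (alpha i + beta + msize%:R + (n i)%:R) /
   (Gamma (beta + msize%:R) * Gamma (alpha i + 1))).

End Multi.
End Defs.

(* Main.v *)
Require Import Defs.
From HB Require Import structures.
From mathcomp Require Import all_boot all_order all_algebra.
From mathcomp Require Import all_classical all_reals all_analysis.
From mathcomp Require Import measurable_realfun.
From mathcomp Require Import ring lra zify.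
Import Order.TTheory GRing.Theory Num.Theory.
Import numFieldNormedType.Exports.
Local Open Scope classical_set_scope.
Local Open Scope ring_scope.

(* Let [N = |n|], let [z = alpha_i + l] with [l < n_i] run over the [N] nodes,
   and let [d_z] be the coefficient of [x^l] in [P_i].  By Euler's Beta integral
   the [j]-th moment is [sum_z e_z q_j(z)], where
     [e_z = d_z Gamma(z + 1) Gamma(beta + 1) / Gamma(z + beta + N + 1)] and
     [q_j(z) = (z + 1)_j (z + beta + j + 2)_(N - 1 - j)].
   The [q_j] span the polynomials of degree less than [N], and at
   [y = - (beta + N)] they all vanish except [q_(N - 1)].  So the type I
   conditions say that [f |-> sum_z e_z f(z)] is [f |-> f(y) / q_(N - 1)(y)] on
   these polynomials, that is, that [e_z] is the value at [y] of the Lagrange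
   polynomial of [z], divided by [q_(N - 1)(y)].  This gives existence and
   uniqueness at once, and it determines [d_z], which is then matched with the
   hypergeometric coefficient. *)

(** * Translation and dilation of Lebesgue integrals over the real line *)

Section change_of_variable.
Context {R : realType}.
Local Notation mu := (@lebesgue_measure R).
Local Open Scope ereal_scope.

(** The pushforward of Lebesgue measure under a translation has the same values on half-open
    intervals, hence is Lebesgue measure by uniqueness. *)
Lemma ge0_integral_shift (f : R -> \bar R) (c : R) :
  measurable_fun [set: R] f -> (forall x, 0 <= f x) ->
  \int[mu]_x f (x + c)%R = \int[mu]_x f x.
Proof.
move=> mf f0.
pose phi := (fun x : R => x + c)%R  : measurableTypeR R -> measurableTypeR R.
have mphi : measurable_fun [set: measurableTypeR R] phi.
  by apply: measurable_funD; [exact: measurable_id|exact: measurable_cst].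
rewrite -[in LHS](preimage_setT phi).
rewrite -(@ge0_integral_pushforward _ _ _ _ R phi mphi _ setT f)//.
apply: eq_measure_integral => //= A mA _; apply/esym/lebesgue_measure_unique => //.
move=> _ [[a b]] _ <- /=.
rewrite /pushforward /=.
rewrite (_ : phi @^-1` _ = `](a - c)%R, (b - c)%R]%classic); last first.
  by apply/seteqP; split => x /=; rewrite !in_itv/= ltrBlDr lerBrDr.
rewrite !lebesgue_measure_itv/= !lte_fin ltrD2r; case: ifP => // _.
by rewrite -!EFinB; congr (_%:E); lra.
Qed.

(** Same argument as for translations: [c] times the pushforward under multiplication by [c] agrees
    with Lebesgue measure on half-open intervals. *)
Lemma ge0_integral_dilate (f : R -> \bar R) (c : R) : (0 < c)%R ->
  measurable_fun [set: R] f -> (forall x, 0 <= f x) ->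
  \int[mu]_x f x = c%:E * \int[mu]_x f (c * x)%R.
Proof.
move=> c0 mf f0.
pose phi := (fun x : R => c * x)%R  : measurableTypeR R -> measurableTypeR R.
have mphi : measurable_fun [set: measurableTypeR R] phi.
  by apply: measurable_funM; [exact: measurable_cst|exact: measurable_id].
rewrite -[in RHS](preimage_setT phi).
rewrite -(@ge0_integral_pushforward _ _ _ _ R phi mphi _ setT f)//.
have cn : (0 <= c)%R by exact: ltW.
rewrite -[c%:E]/((NngNum cn)%:num%:E) -ge0_integral_mscale//.
apply: eq_measure_integral => //= A mA _; apply/lebesgue_measure_unique => //.
move=> _ [[a b]] _ <- /=.
rewrite /mscale/= /pushforward /=.
rewrite (_ : phi @^-1` _ = `](a / c)%R, (b / c)%R]%classic); last first.
  by apply/seteqP; split => x /=; rewrite !in_itv/= ltr_pdivrMr// ler_pdivlMr// mulrC.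
rewrite !lebesgue_measure_itv/= !lte_fin ltr_pM2r ?invr_gt0//; case: ifP => // _.
  by rewrite -!EFinB -EFinM; congr (_%:E); field; rewrite gt_eqF.
by rewrite mule0.
Qed.

End change_of_variable.

(** * The Gamma and Beta functions *)

Section beta_gamma.
Context {R : realType}.
Local Notation mu := (@lebesgue_measure R).
Implicit Types a b x t : R.

(* [`^] is [1] on negative bases, hence the indicator. *)
Definition pow_pos a x : R := x `^ (a - 1) * \1_(`]0, +oo[%classic : set R) x.

Lemma pow_posE a x : 0 < x -> pow_pos a x = x `^ (a - 1).
Proof. by move=> x0; rewrite /pow_pos indicE mem_set ?mulr1//= in_itv/= x0. Qed.

Lemma pow_pos_eq0 a x : x <= 0 -> pow_pos a x = 0.
Proof.
move=> x0; rewrite /pow_pos indicE memNset ?mulr0//= in_itv/= andbT.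
by apply/negP; rewrite -leNgt.
Qed.

Lemma pow_pos_ge0 a x : 0 <= pow_pos a x.
Proof. by rewrite /pow_pos mulr_ge0// powR_ge0. Qed.

Lemma pow_posMl a t x : 0 < t -> pow_pos a (t * x) = t `^ (a - 1) * pow_pos a x.
Proof.
move=> t0; have [x0|x0] := ltP 0 x.
  by rewrite !pow_posE ?mulr_gt0// powRM// ltW.
by rewrite !pow_pos_eq0 ?mulr0// pmulr_rle0.
Qed.

Lemma measurable_pow_pos a : measurable_fun [set: R] (pow_pos a).
Proof.
apply: measurable_funM; first exact: measurable_powR.
by apply: measurable_indic; exact: measurable_itv.
Qed.

(** The value stays in the extended reals, so that Tonelli's theorem applies before finiteness is
    known. *)
Definition gamma_integral a : \bar R := (\int[mu]_t (pow_pos a t * expR (- t))%:E)%E.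

Definition beta_integral a b : \bar R :=
  (\int[mu]_t (pow_pos a t * pow_pos b (1 - t))%:E)%E.

Lemma integral_oy_pow_pos a (f : R -> R) :
  (\int[mu]_(t in `]0%R, +oo[) (t `^ (a - 1) * f t)%:E =
   \int[mu]_t (pow_pos a t * f t)%:E)%E.
Proof.
rewrite integral_mkcond; apply: eq_integral => t _; rewrite patchE.
case: ifPn => [|tn].
  by rewrite inE/= in_itv/= andbT => t0; rewrite pow_posE.
rewrite pow_pos_eq0 ?mul0r// leNgt; apply: contra tn => t0.
by rewrite inE/= in_itv/= t0.
Qed.

Lemma GammaE a : Gamma a = fine (gamma_integral a).
Proof.
rewrite /Gamma /Rintegral /gamma_integral -integral_oy_pow_pos; congr fine.
rewrite integral_itv_obnd_cbnd//; apply/measurable_EFinP; apply: measurable_funTS.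
apply: measurable_funM; first exact: measurable_powR.
exact: measurableT_comp.
Qed.

Lemma beta_integralE a b :
  (\int[mu]_(t in `[0%R, 1%R]) (t `^ (a - 1) * (1 - t) `^ (b - 1))%:E =
   beta_integral a b)%E.
Proof.
have mf D : measurable_fun D (fun t => t `^ (a - 1) * (1 - t) `^ (b - 1))%R.
  apply: measurable_funTS; apply: measurable_funM; first exact: measurable_powR.
  apply: (measurableT_comp (measurable_powR (b - 1)) (g := fun t : R => 1 - t)).
  exact: measurable_funB.
rewrite -integral_itv_obnd_cbnd; last exact/measurable_EFinP.
rewrite -integral_itv_bndo_bndc; last exact/measurable_EFinP.
rewrite /beta_integral integral_mkcond; apply: eq_integral => t _; rewrite patchE.
case: ifPn => [|tn].
  by rewrite inE/= in_itv/= => /andP[t0 t1]; rewrite !pow_posE// subr_gt0.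
have [t0|t0] := leP t 0; first by rewrite pow_pos_eq0 ?mul0r.
have [t1|t1] := leP 1 t; first by rewrite (pow_pos_eq0 b) ?mulr0// subr_le0.
by move: tn; rewrite notin_setE/= in_itv/= t0 t1.
Qed.

Lemma gamma_integral_ge0 a : (0 <= gamma_integral a)%E.
Proof.
by apply: integral_ge0 => t _; rewrite lee_fin mulr_ge0 ?pow_pos_ge0// expR_ge0.
Qed.

Lemma beta_integral_ge0 a b : (0 <= beta_integral a b)%E.
Proof.
by apply: integral_ge0 => t _; rewrite lee_fin; apply: mulr_ge0; exact: pow_pos_ge0.
Qed.

(* In the double integral of [s^(a-1) t^(b-1) e^(-s-t)], substitute [t = u - s],
   exchange the integrals, and substitute [s = u x]. *)
Lemma gamma_mul_beta a b :
  (gamma_integral a * gamma_integral b = beta_integral a b * gamma_integral (a + b))%E.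
Proof.
pose f (z : measurableTypeR R * measurableTypeR R) : \bar R :=
  (pow_pos a z.1 * pow_pos b (z.2 - z.1) * expR (- z.2))%:E.
have f0 z : (0 <= f z)%E.
  by rewrite lee_fin; do 2?apply: mulr_ge0; rewrite ?pow_pos_ge0 ?expR_ge0.
have mg c : measurable_fun [set: measurableTypeR R]
    (fun t => (pow_pos c t * expR (- t))%:E).
  apply/measurable_EFinP; apply: measurable_funM; first exact: measurable_pow_pos.
  exact: measurableT_comp.
have g0 c (t : R) : (0 <= (pow_pos c t * expR (- t))%:E)%E.
  by rewrite lee_fin mulr_ge0 ?pow_pos_ge0 ?expR_ge0.
have mf : measurable_fun setT f.
  apply/measurable_EFinP; apply: measurable_funM; last first.
    by apply: measurableT_comp => //; exact: measurableT_comp.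
  apply: measurable_funM.
    by apply: measurableT_comp; [exact: measurable_pow_pos|exact: measurable_fst].
  apply: measurableT_comp; first exact: measurable_pow_pos.
  by apply: measurable_funB; [exact: measurable_snd|exact: measurable_fst].
transitivity (\int[mu]_s \int[mu]_u f (s, u))%E.
  rewrite -ge0_integralZr//; last exact: gamma_integral_ge0.
  apply: eq_integral => s _.
  rewrite -(@ge0_integral_shift _ (fun t => f (s, t)) s)//; last first.
    exact: (measurableT_comp mf (measurable_pair1 _)).
  rewrite -ge0_integralZl//.
  apply: eq_integral => t _; rewrite -EFinM /f/=; congr (_%:E).
  by rewrite addrK opprD expRD; ring.
transitivity (\int[mu]_u \int[mu]_s f (s, u))%E; first exact: fubini_tonelli.
rewrite -ge0_integralZl//; last exact: beta_integral_ge0.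
apply: eq_integral => u _; rewrite /f/=.
have [u0|u0] := leP u 0.
  rewrite (pow_pos_eq0 (a + b))// mul0r mule0 integral0_eq// => s _.
  have [s0|s0] := leP s 0; first by rewrite pow_pos_eq0 ?mul0r.
  by rewrite (pow_pos_eq0 b) ?mulr0 ?mul0r// subr_le0 (le_trans u0) ?ltW.
rewrite (@ge0_integral_dilate _ (fun s => f (s, u)) u)//; last first.
  exact: (measurableT_comp mf (measurable_pair2 _)).
transitivity (u%:E * \int[mu]_s ((u `^ (a - 1) * u `^ (b - 1) * expR (- u))%:E *
    (pow_pos a s * pow_pos b (1 - s))%:E))%E.
  congr (_ * _)%E; apply: eq_integral => s _; rewrite /f/= -EFinM; congr (_%:E).
  by rewrite -[X in X - u * s]mulr1 -mulrBr !pow_posMl//; ring.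
have mb : measurable_fun [set: measurableTypeR R]
    (fun s => (pow_pos a s * pow_pos b (1 - s))%:E).
  apply/measurable_EFinP; apply: measurable_funM; first exact: measurable_pow_pos.
  apply: (measurableT_comp (measurable_pow_pos b) (g := fun s : R => 1 - s)).
  exact: measurable_funB.
rewrite ge0_integralZl//; last 2 first.
- by move=> s _; rewrite lee_fin; apply: mulr_ge0; exact: pow_pos_ge0.
- by rewrite lee_fin; rewrite !mulr_ge0 ?powR_ge0 ?expR_ge0.
rewrite muleA -EFinM muleC pow_posE//; congr (_ * _%:E)%E.
(* The summand 1 is the Jacobian [u] of the dilation; the other two come from the two power
   factors. *)
rewrite (_ : a + b - 1 = 1 + (a - 1) + (b - 1)); last by ring.
by rewrite !powRD ?(gt_eqF u0) ?implybT// powRr1 ?ltW//; ring.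
Qed.

Lemma gamma_integral1 : gamma_integral 1 = 1%E.
Proof.
rewrite /gamma_integral -integral_oy_pow_pos.
under eq_integral do rewrite subrr powRr0 mul1r.
rewrite integral_itv_obnd_cbnd; last first.
  apply/measurable_EFinP; apply: measurable_funTS.
  exact: measurableT_comp.
rewrite (@ge0_continuous_FTC2y _ _ (fun x => - expR (- x)) _ 0)//.
- by rewrite oppr0 expR0 -EFinB sub0r opprK.
- apply: continuous_subspaceT => x; apply: continuous_comp.
    exact: opp_continuous.
  exact: continuous_expR.
- rewrite -oppr0; apply: cvgN; exact: cvgr_expR.
- apply: cvg_at_right_filter; apply: cvgN; apply: cvg_comp.
    exact: opp_continuous.
  exact: continuous_expR.
- by move=> x _; rewrite derive1E derive_val; ring.
Qed.

(** For [a < 1] the integrand is singular at 0, so the antiderivative [t^a / a] is used on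
    [[e n, 1]], and monotone convergence gives the limit as [e n] tends to 0. *)
Lemma beta_integral1 a : 0 < a -> beta_integral a 1 = (a^-1)%:E.
Proof.
move=> a0; rewrite -beta_integralE.
under eq_integral do rewrite subrr powRr0 mulr1.
have mf D : measurable_fun D (fun t : measurableTypeR R => (t `^ (a - 1))%:E).
  by apply/measurable_EFinP; apply: measurable_funTS; exact: measurable_powR.
rewrite -integral_itv_obnd_cbnd; last exact: mf.
(* The shift by 2 keeps [e n < 1] already for [n = 0], so that every interval is nondegenerate. *)
pose e (n : nat) : R := n.+2%:R^-1.
have e0 n : 0 < e n by rewrite invr_gt0 ltr0n.
have e1 n : e n < 1 by rewrite invf_lt1 ?ltr0n// ltr1n.
have eE n : (\int[mu]_(t in `[e n, 1%R]) (t `^ (a - 1))%:E =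
    (a^-1)%:E - (a^-1 * e n `^ a)%:E)%E.
  have der (x : R) : 0 < x -> is_derive x 1 (fun t => a^-1 * t `^ a) (x `^ (a - 1)).
    move=> x0; apply: (is_derive_eq (is_deriveZ a^-1 (is_derive1_powR a x0))).
    by rewrite /GRing.scale/= mulrA mulVf ?mul1r// gt_eqF.
  have cF (x : R) : 0 < x -> {for x, continuous (fun t => a^-1 * t `^ a)}.
    move=> x0; apply: differentiable_continuous; apply/derivable1_diffP.
    exact: (@ex_derive _ _ _ _ _ _ _ (der x x0)).
  have gt0 x : x \in `]e n, 1[ -> 0 < x.
    by rewrite in_itv/= => /andP[+ _]; exact: lt_trans.
  rewrite (@continuous_FTC2 _ _ (fun t => a^-1 * t `^ a) _ _ (e1 n)).
  - by rewrite powR1 mulr1.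
  - apply: derivable_within_continuous => x; rewrite in_itv/= => /andP[ex _].
    by apply: derivable_powR; rewrite in_itv/= andbT (lt_le_trans _ ex).
  - split.
    + by move=> x /gt0 x0; exact: (@ex_derive _ _ _ _ _ _ _ (der x x0)).
    + by apply: cvg_at_right_filter; exact: cF.
    + by apply: cvg_at_left_filter; exact: cF.
  - by move=> x /gt0 x0; rewrite derive1E (@derive_val _ _ _ _ _ _ _ (der x x0)).
have bigE : \bigcup_n `[e n, 1%R]%classic = `]0%R, 1%R]%classic.
  apply/seteqP; split => [x [n _]|x] /=; rewrite !in_itv/= => /andP[ex x1].
    by rewrite x1 andbT (lt_le_trans (e0 n)).
  exists (Num.truncn x^-1) => //=; rewrite in_itv/= x1 andbT invf_ple ?posrE//.
  by rewrite (le_trans (ltW (truncnS_gt _)))// ler_nat.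
have lim1 : (\int[mu]_(t in `[e n, 1%R]) (t `^ (a - 1))%:E @[n --> \oo] -->
    \int[mu]_(t in `]0%R, 1%R]) (t `^ (a - 1))%:E)%E.
  rewrite -bigE; apply: ge0_nondecreasing_set_cvg_integral => //.
  - move=> m n mn; rewrite subsetEset => x /=; rewrite !in_itv/= => /andP[ex ->].
    by rewrite andbT (le_trans _ ex)// lef_pV2 ?posrE// ler_nat.
  - by move=> n t _; rewrite lee_fin powR_ge0.
have lim2 : (\int[mu]_(t in `[e n, 1%R]) (t `^ (a - 1))%:E @[n --> \oo] -->
    (a^-1)%:E)%E.
  under eq_fun do rewrite eE -EFinB.
  apply: cvg_EFin; first exact: nearW.
  rewrite -[X in _ --> X]subr0 -[X in _ --> _ - X](mulr0 a^-1).
  apply: cvgB; first exact: cvg_cst.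
  apply: cvgMr; move/cvg_at_rightP: (powR_cvg0 a0); apply; split => //.
  by have := @cvg_harmonic R; rewrite -cvg_shiftS.
exact: cvg_unique lim1 lim2.
Qed.


(** This is the product formula at [b = 1], where the Beta integral is [1 / a]; no integration by
    parts is involved. *)
Lemma gamma_integralS a : 0 < a ->
  gamma_integral (a + 1) = (a%:E * gamma_integral a)%E.
Proof.
move=> a0; have := gamma_mul_beta a 1.
rewrite gamma_integral1 beta_integral1// mule1 => ->.
by rewrite muleA -EFinM mulfV ?gt_eqF// mul1e.
Qed.

Lemma gamma_integral_nat n : gamma_integral n.+1%:R = (n`!%:R)%:E.
Proof.
elim: n => [|n IHn]; first exact: gamma_integral1.
by rewrite -[n.+2%:R]natr1 gamma_integralS// IHn -EFinM -natrM -factS.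
Qed.

(* With factorials at one end or in the middle, this bounds [Gamma] from above
   and from below, so it yields both finiteness and positivity. *)
Lemma gamma_integral_le_add a b c : a <= b <= c ->
  (gamma_integral b <= gamma_integral a + gamma_integral c)%E.
Proof.
move=> /andP[ab bc].
have mg d : measurable_fun [set: measurableTypeR R]
    (fun t => (pow_pos d t * expR (- t))%:E).
  apply/measurable_EFinP; apply: measurable_funM; first exact: measurable_pow_pos.
  exact: measurableT_comp.
have g0 d (t : R) : (0 <= (pow_pos d t * expR (- t))%:E)%E.
  by rewrite lee_fin mulr_ge0 ?pow_pos_ge0 ?expR_ge0.
rewrite -ge0_integralD//; apply: ge0_le_integral => //.
  exact: emeasurable_funD.
move=> t _; rewrite -EFinD lee_fin -mulrDl ler_wpM2r ?expR_ge0//.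
have [t0|t0] := leP t 0; first by rewrite !pow_pos_eq0 ?addr0.
(* The power [t^(b-1)] is dominated by [t^(a-1)] on []0, 1]] and by [t^(c-1)] beyond 1. *)
rewrite !pow_posE//; have [t1|t1] := leP t 1.
  by rewrite ler_wpDr ?powR_ge0// ger_powR ?t0//; lra.
by rewrite ler_wpDl ?powR_ge0// ler_powR ?(ltW t1)//; lra.
Qed.

Lemma gamma_integral_lty a : 0 < a -> (gamma_integral a < +oo)%E.
Proof.
(* While [a] may lie below 1, [a + 1] lies between 1 and an integer, where the integrals are
   factorials. The recurrence carries finiteness back to [a]. *)
move=> a0; suff : (gamma_integral (a + 1) < +oo)%E.
  rewrite gamma_integralS// !ltey; apply: contraNneq => ->.
  by rewrite gt0_muley ?lte_fin.
apply: (@le_lt_trans _ _ (gamma_integral 1%:R +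
    gamma_integral (Num.truncn (a + 1)).+1%:R)%E).
  apply: gamma_integral_le_add; rewrite (ltW (truncnS_gt _)) andbT.
  by rewrite lerDr ltW.
by rewrite !gamma_integral_nat -EFinD ltry.
Qed.

Lemma gamma_integralE a : 0 < a -> gamma_integral a = (Gamma a)%:E.
Proof.
move=> a0; rewrite GammaE fineK// ge0_fin_numE ?gamma_integral_lty//.
exact: gamma_integral_ge0.
Qed.

Lemma GammaS a : 0 < a -> Gamma (a + 1) = a * Gamma a.
Proof.
move=> a0; apply: EFin_inj.
by rewrite EFinM -!gamma_integralE ?gamma_integralS ?addr_gt0.
Qed.

Lemma GammaD a n : 0 < a -> Gamma (a + n%:R) = poch a n * Gamma a.
Proof.
move=> a0; elim: n => [|n IHn]; first by rewrite /poch big_ord0 addr0 mul1r.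
rewrite -natr1 addrA GammaS ?IHn; last by rewrite ltr_wpDr.
by rewrite /poch big_ord_recr/=; ring.
Qed.

Lemma Gamma_gt0 a : 0 < a -> 0 < Gamma a.
Proof.
move=> a0; rewrite lt_def; apply/andP; split; last first.
  by rewrite -lee_fin -gamma_integralE ?gamma_integral_ge0.
apply/eqP => G0; set n := (Num.truncn a).+1.
have an : a <= n%:R by rewrite ltW// truncnS_gt.
(* If [Gamma a] vanished, so would [Gamma (a + n)] by the recurrence, and this bound would make the
   factorial [Gamma n] at most 0. *)
have := @gamma_integral_le_add a n%:R (a + n%:R); rewrite an lerDr ltW//.
move=> /(_ isT); rewrite gamma_integral_nat !gamma_integralE ?addr_gt0// GammaD//.
by rewrite G0 mulr0 -EFinD addr0 lee_fin leNgt ltr0n fact_gt0.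
Qed.

Lemma beta_integral_Gamma a b : 0 < a -> 0 < b ->
  beta_integral a b = (Gamma a * Gamma b / Gamma (a + b))%:E.
Proof.
move=> a0 b0; have G0 := Gamma_gt0 _ (addr_gt0 a0 b0).
have := gamma_mul_beta a b; rewrite !gamma_integralE ?addr_gt0//.
(* Nonnegativity leaves a finite value or [+oo]; the latter, multiplied by [Gamma (a + b) > 0],
   cannot equal the finite product [Gamma a * Gamma b]. *)
have := beta_integral_ge0 a b.
case: (beta_integral a b) => [r _||//].
  by rewrite -!EFinM => -[->]; rewrite mulfK ?gt_eqF.
by move=> _; rewrite gt0_mulye ?lte_fin.
Qed.

End beta_gamma.

(** * Moments of the Jacobi weight *)

Section moments.
Context {R : realType}.
Local Notation mu := (@lebesgue_measure R).
Implicit Types a b beta : R.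

Lemma jacobi_weight_integral a b : -1 < a -> -1 < b ->
  (\int[mu]_(x in `[0%R, 1%R]) (x `^ a * (1 - x) `^ b)%:E =
   (Gamma (a + 1) * Gamma (b + 1) / Gamma (a + b + 2))%:E)%E.
Proof.
move=> a1 b1; rewrite (_ : a + b + 2 = a + 1 + (b + 1)); last by ring.
rewrite -beta_integral_Gamma -?beta_integralE ?addrK; [by []|lra..].
Qed.

Lemma jacobi_weight_integrable a b : -1 < a -> -1 < b ->
  mu.-integrable `[0%R, 1%R] (fun x => (x `^ a * (1 - x) `^ b)%:E).
Proof.
move=> a1 b1; apply/integrableP; split.
  apply/measurable_EFinP; apply: measurable_funTS; apply: measurable_funM.
    exact: measurable_powR.
  apply: (measurableT_comp (measurable_powR b) (g := fun t : R => 1 - t)).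
  exact: measurable_funB.
under eq_integral do rewrite gee0_abs ?lee_fin ?mulr_ge0 ?powR_ge0//.
by rewrite jacobi_weight_integral// ltry.
Qed.

Lemma jacobi_momentE beta a (q : {poly R}) (j m : nat) : -1 < a -> -1 < beta ->
  (size q <= m)%N ->
  jacobi_moment beta a q j =
  (\sum_(l < m) q`_l * (Gamma (a + l%:R + j%:R + 1) * Gamma (beta + 1) /
     Gamma (a + l%:R + j%:R + beta + 2)))%:E.
Proof.
move=> a1 b1 qm; rewrite /jacobi_moment.
have ai (l : nat) : -1 < a + l%:R + j%:R by rewrite -addrA -natrD ltr_wpDr.
transitivity (\int[mu]_(x in `[0%R, 1%R]) \sum_(l < m)
    ((q`_l)%:E * (x `^ (a + l%:R + j%:R) * (1 - x) `^ beta)%:E))%E.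
  apply: eq_integral => x; rewrite inE/= in_itv/= => /andP[x0 x1].
  under eq_bigr do rewrite -EFinM.
  rewrite sumEFin; congr (_%:E); rewrite (horner_coef_wide _ qm).
  rewrite mulr_sumr mulr_suml; apply: eq_bigr => l _.
  suff -> : x `^ (a + l%:R + j%:R) = x ^+ j * x ^+ l * x `^ a by ring.
  rewrite -exprD -powR_mulrn// -addrA [RHS]mulrC addnC natrD.
  (* At [x = 0] the exponent law needs a nonzero total exponent. It is positive if [l + j >= 1],
     since [a > -1]; the case [l + j = 0], where [a = 0] is possible, is trivial. *)
  have [lj|lj] := posnP (l + j)%N; first by rewrite -natrD lj !powRr0 !addr0 mulr1.
  rewrite powRD// (@gt_eqF _ _ (a + _)) // -natrD.
  have : 1 <= (l + j)%:R :> R by rewrite (ler_nat _ 1).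
  lra.
rewrite integral_sum//; last first.
  by move=> l; apply: integrableZl => //; exact: jacobi_weight_integrable.
rewrite -sumEFin; apply: eq_bigr => l _.
rewrite integralZl//; last exact: jacobi_weight_integrable.
by rewrite jacobi_weight_integral.
Qed.

End moments.

(** * Lagrange interpolation and the moment polynomials *)

Section interpolation.
Variables (F : fieldType) (I : finType) (z : I -> F).

Lemma size_prod_XsubC_neq (u : I) :
  size (\prod_(v | v != u) ('X - (z v)%:P)) = #|I|.
Proof.
rewrite -big_filter size_prod_XsubC (_ : size _ = #|predC1 u|).
  by rewrite cardC1 prednK//; apply/card_gt0P; exists u.
by rewrite cardE /enum_mem /index_enum; case: index_enum_key.
Qed.

Hypothesis z_inj : injective z.

(** The difference of [f] and its interpolant has degree below [#|I|] and vanishes at [#|I|]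
    distinct nodes. *)
Lemma lagrange_interpolation (f : {poly F}) (y : F) : (size f <= #|I|)%N ->
  f.[y] = \sum_u f.[z u] * \prod_(v | v != u) ((y - z v) / (z u - z v)).
Proof.
move=> sf.
pose g : {poly F} := \sum_u f.[z u] *:
  \prod_(v | v != u) ((z u - z v)^-1 *: ('X - (z v)%:P)).
have gE x : g.[x] = \sum_u f.[z u] * \prod_(v | v != u) ((x - z v) / (z u - z v)).
  rewrite /g horner_sum; apply: eq_bigr => u _; rewrite hornerZ horner_prod.
  by congr (_ * _); apply: eq_bigr => v _; rewrite hornerZ hornerXsubC mulrC.
rewrite -gE; congr (_.[y]); apply/eqP; rewrite -subr_eq0.
have gz u : g.[z u] = f.[z u].
  rewrite gE (bigD1 u)//= [X in _ + X]big1 ?addr0 => [|v vu].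
    by rewrite big1 ?mulr1// => v vu; rewrite mulfV// subr_eq0 (inj_eq z_inj) eq_sym.
  by rewrite (bigD1 u) 1?eq_sym//= subrr !mul0r mulr0.
apply/eqP/(@roots_geq_poly_eq0 _ _ [seq z u | u <- enum I]).
- by apply/allP => _ /mapP[u _ ->]; rewrite rootE hornerD hornerN gz subrr.
- by rewrite map_inj_uniq ?enum_uniq.
rewrite size_map -cardE (leq_trans (size_polyD _ _))// geq_max sf size_polyN.
apply: (leq_trans (size_sum _ _ _)); apply/bigmax_leqP => u _.
apply: (leq_trans (size_scale_leq _ _)).
rewrite scaler_prod; apply: (leq_trans (size_scale_leq _ _)).
by rewrite size_prod_XsubC_neq.
Qed.

End interpolation.

Section moment_polynomials.
Context {R : realType}.
Implicit Types (x beta : R) (f : {poly R}).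

Lemma poch0 x : poch x 0 = 1.
Proof. by rewrite /poch big_ord0. Qed.

Lemma pochSr x m : poch x m.+1 = poch x m * (x + m%:R).
Proof. by rewrite /poch big_ord_recr. Qed.

Lemma pochD x m k : poch x (m + k) = poch x m * poch (x + m%:R) k.
Proof.
elim: k => [|k IHk]; first by rewrite addn0 poch0 mulr1.
by rewrite addnS !pochSr IHk -mulrA -addrA -natrD.
Qed.

Lemma pochN x m : poch (- x) m = (-1) ^+ m * poch (x - m%:R + 1) m.
Proof.
rewrite /poch (reindex_inj rev_ord_inj) -[m in (-1) ^+ m]card_ord -prodrN /=.
apply: eq_bigr => k _; rewrite natrB ?ltn_ord// -natr1; ring.
Qed.

Lemma poch_gt0 x m : 0 < x -> 0 < poch x m.
Proof. by move=> x0; apply: prodr_gt0 => k _; rewrite ltr_wpDr. Qed.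

Definition moment_poly beta (N j : nat) : {poly R} :=
  \prod_(k < j) ('X + (1 + k%:R)%:P) *
  \prod_(k < N - j.+1) ('X + (beta + j%:R + 2 + k%:R)%:P).

Lemma horner_moment_poly beta N j x : (moment_poly beta N j).[x] =
  poch (x + 1) j * poch (x + beta + j%:R + 2) (N - j.+1).
Proof.
rewrite hornerM !horner_prod; congr (_ * _).
  by apply: eq_bigr => k _; rewrite hornerD hornerX hornerC addrA.
by apply: eq_bigr => k _; rewrite hornerD hornerX hornerC !addrA.
Qed.

Lemma size_moment_poly beta N j : (j < N)%N -> size (moment_poly beta N j) = N.
Proof.
move=> jN.
have sz m (c : nat -> R) : \prod_(k < m) ('X + (c k)%:P) \is monic /\
    size (\prod_(k < m) ('X + (c k)%:P)) = m.+1.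
  split; first by apply: monic_prod => k _; exact: monicXaddC.
  under eq_bigr do rewrite -[c _]opprK polyCN.
  by rewrite size_prod_XsubC /index_enum -enumT size_enum_ord.
rewrite size_monicM ?(sz _ (fun k => 1 + k%:R)).1 ?monic_neq0//; last first.
  by rewrite (sz _ (fun k => beta + j%:R + 2 + k%:R)).1.
rewrite (sz _ (fun k => 1 + k%:R)).2 (sz _ (fun k => beta + j%:R + 2 + k%:R)).2.
lia.
Qed.

(** The second product is nonempty for these [j], and its last factor is ['X + beta + N]. *)
Lemma moment_poly_root beta N j : (j < N.-1)%N ->
  (moment_poly beta N j).[- (beta + N%:R)] = 0.
Proof.
move=> jN; rewrite horner_moment_poly.
have -> : (N - j.+1)%N = (N - j.+2).+1 by lia.
by rewrite pochSr natrB; [ring|lia].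
Qed.

Lemma moment_poly_last beta N : (0 < N)%N ->
  (moment_poly beta N N.-1).[- (beta + N%:R)] = (-1) ^+ N.-1 * poch (beta + 1) N.-1.
Proof.
case: N => // N _; rewrite horner_moment_poly subnn poch0 mulr1 /= -natr1.
rewrite (_ : - _ + 1 = - (beta + N%:R)); last by ring.
by rewrite pochN addrK.
Qed.

(* All members of level [N.+1] but the last are multiples of
   ['X + beta + N.+1], so an induction on [N] peels off the value at
   [- (beta + N.+1)]. *)
Lemma moment_poly_span beta N f : -1 < beta -> (size f <= N)%N ->
  exists c : nat -> R, f = \sum_(j < N) c j *: moment_poly beta N j.
Proof.
move=> b1; elim: N f => [|N IHN] f.
  by rewrite leqn0 size_poly_eq0 => /eqP ->; exists (fun=> 0); rewrite big_ord0.
move=> sf; set y := - (beta + N.+1%:R); set q := moment_poly beta N.+1 N.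
have q0 : q.[y] != 0.
  rewrite (moment_poly_last _ N.+1)// mulf_neq0 ?signr_eq0//.
  by rewrite gt_eqF// poch_gt0//; lra.
have : root (f - (f.[y] / q.[y]) *: q) y.
  by rewrite rootE hornerD hornerN hornerZ divfK// subrr.
case/factor_theorem => h hE.
have sh : (size h <= N)%N.
  have [->|h0] := eqVneq h 0; first by rewrite size_poly0.
  have : (size (h * ('X - y%:P))%R <= N.+1)%N.
    rewrite -hE (leq_trans (size_polyD _ _))// geq_max sf size_polyN.
    by rewrite (leq_trans (size_scale_leq _ _))// size_moment_poly.
  by rewrite size_Mmonic ?monicXsubC// size_XsubC addn2.
have [c cE] := IHN h sh.
exists (fun j => if (j < N)%N then c j else f.[y] / q.[y]).
rewrite big_ord_recr/= ltnn -/q; apply/eqP; rewrite -subr_eq hE cE; apply/eqP.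
rewrite mulr_suml; apply: eq_bigr => j _; rewrite ltn_ord -scalerAl; congr (_ *: _).
rewrite /moment_poly -mulrA; congr (_ * _).
have -> : (N.+1 - j.+1)%N = (N - j.+1).+1 by have := ltn_ord j; lia.
rewrite big_ord_recr/=; congr (_ * _); rewrite /y polyCN opprK; congr ('X + _%:P).
by rewrite natrB// -!natr1; ring.
Qed.

End moment_polynomials.

(** * The moment equations solved by interpolation *)

Section moment_system.
Context {R : realType}.

Lemma moment_system (beta : R) (I : finType) (z e : I -> R) : injective z ->
  -1 < beta -> (0 < #|I|)%N ->
  (forall j, (j < #|I|)%N ->
     \sum_u e u * (moment_poly beta #|I| j).[z u] = (j == #|I|.-1)%:R) <->
  (forall u, e u = ((-1) ^+ #|I|.-1 * poch (beta + 1) #|I|.-1)^-1 *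
     \prod_(v | v != u) ((- (beta + #|I|%:R) - z v) / (z u - z v))).
Proof.
move=> z_inj b1 N0; set N := #|I|; set y := - (beta + N%:R); set c := _ * poch _ _.
have c0 : c != 0 by rewrite mulf_neq0 ?signr_eq0// gt_eqF// poch_gt0//; lra.
have qy j : (j < N)%N -> (moment_poly beta N j).[y] = c *+ (j == N.-1).
  move=> jN; case: eqVneq => [->|jN1]; first by rewrite moment_poly_last.
  by rewrite moment_poly_root//; move/eqP: jN1; lia.
split=> [eq_mom u|eE j jN].
(* By linearity, the equations for the spanning family identify the functional on all polynomials of
   degree below [N]. *)
- have eval (f : {poly R}) : (size f <= N)%N -> \sum_v e v * f.[z v] = c^-1 * f.[y].
    move=> /(moment_poly_span _ _ _ b1)[a ->].
    under eq_bigr do rewrite horner_sum mulr_sumr.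
    rewrite exchange_big horner_sum mulr_sumr; apply: eq_bigr => j _ /=.
    under eq_bigr do rewrite hornerZ mulrCA.
    rewrite -mulr_sumr eq_mom// hornerZ qy//; case: eqP => _; last by rewrite !mulr0.
    by rewrite mulr1n mulrCA mulVf.
  (* This test polynomial vanishes at every node except that of [u], so the functional isolates
     [e u]. *)
  pose f := \prod_(v | v != u) ('X - (z v)%:P).
  have zu v : v != u -> z u - z v != 0.
    by move=> vu; rewrite subr_eq0 (inj_eq z_inj) eq_sym.
  have fu : f.[z u] != 0.
    by rewrite horner_prod; apply/prodf_neq0 => v /zu; rewrite hornerXsubC.
  have := eval f; rewrite (bigD1 u)//= big1 => [|v vu]; last first.
    by rewrite horner_prod (bigD1 v)//= hornerXsubC subrr mul0r mulr0.
  rewrite addr0 size_prod_XsubC_neq => /(_ (leqnn _)) fE.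
  apply: (mulIf fu); rewrite fE -mulrA; congr (_ * _).
  rewrite !horner_prod -big_split/=; apply: eq_bigr => v /zu vu.
  by rewrite !hornerXsubC divfK.
(* Conversely, the equation for [j] is the Lagrange formula for [moment_poly] at [y], divided by
   [c]. *)
- have := eq_leq (size_moment_poly beta _ _ jN).
  move=> /(lagrange_interpolation _ _ _ z_inj _ y).
  rewrite qy// -mulr_natr => /(congr1 ( *%R c^-1)); rewrite mulKf// => ->.
  rewrite mulr_sumr; apply: eq_bigr => u _.
  by rewrite eE -mulrA; congr (_ * _); rewrite mulrC.
Qed.

End moment_system.

(** * Terminating series and Pochhammer identities *)

Section hypergeometric_coefficients.
Context {R : realType}.
Implicit Types (a w d x : R) (m n l : nat).

(** The partial sums are constant from index [m] on, so their limit is that constant. *)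
Lemma hypergeom_terminating (a c : seq R) x m :
  (forall l, (m <= l)%N -> \prod_(t <- a) poch t l = 0) ->
  hypergeom a c x = \sum_(l < m)
    (\prod_(t <- a) poch t l) / (\prod_(t <- c) poch t l) * (x ^+ l / (l`!)%:R).
Proof.
move=> a0; rewrite /hypergeom; set u := fun l => _.
apply: lim_near_cst => //; exists m => // k /= mk.
rewrite /series/= (big_cat_nat (n := m))//= big_mkord [X in _ + X]big1_seq ?addr0//.
by move=> l; rewrite mem_index_iota => /andP[_ /andP[ml _]]; rewrite /u a0// !mul0r.
Qed.

Lemma poch_nat1 n : poch 1 n = (n`!)%:R :> R.
Proof.
elim: n => [|n IHn]; first exact: poch0.
by rewrite pochSr IHn factS mulnC natrM -natr1 addrC.
Qed.

Lemma poch_neg_nat0 n l : (n < l)%N -> poch (- n%:R) l = 0 :> R.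
Proof.
by move=> nl; rewrite /poch (bigD1 (Ordinal nl))//= addrC subrr mul0r.
Qed.

Lemma poch_neq0 d n : d \isn't a Num.int -> poch d n != 0.
Proof.
move=> dn; apply/prodf_neq0 => k _; apply: contra dn => /eqP dk.
by rewrite (_ : d = - k%:R) ?rpredN ?rpred_nat//; lra.
Qed.

(** Up to the common sign [(-1)^l], both sides are the product of the [n + l] consecutive factors
    from [d - l] to [d + n - 1], cut at different places. *)
Lemma poch_reflection d n l :
  poch (1 - d - n%:R) l * poch (d - l%:R) n = poch d n * poch (1 - d) l.
Proof.
rewrite (_ : 1 - d - n%:R = - (d + n%:R - 1)); last by ring.
rewrite (_ : 1 - d = - (d - 1)); last by ring.
rewrite !pochN (_ : d + n%:R - 1 - l%:R + 1 = d - l%:R + n%:R); last by ring.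
rewrite (_ : d - 1 - l%:R + 1 = d - l%:R); last by ring.
rewrite -mulrA [X in _ * X]mulrC -pochD addnC pochD subrK; ring.
Qed.

Lemma prod_ord_neq (h : nat -> R) n (l : 'I_n) :
  \prod_(m < n | m != l) h m =
  \prod_(m < l) h m * \prod_(k < n - l.+1) h (l.+1 + k)%N.
Proof.
have <- : \prod_(0 <= m < n | m != l) h m = \prod_(m < n | m != l) h m.
  exact: big_mkord.
rewrite (big_cat_nat (leq0n l) (ltnW (ltn_ord l))).
rewrite [X in _ * X = _]big_ltn_cond ?ltn_ord// eqxx; congr (_ * _).
  by rewrite big_mkord; apply: eq_bigl => m; rewrite ltn_eqF.
rewrite -{1}[l.+1]add0n big_addn big_mkord; apply: eq_big => m; last by rewrite addnC.
by rewrite gtn_eqF// addnS ltnS leq_addl.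
Qed.

End hypergeometric_coefficients.

(** * The type I polynomials *)

Section nodes.
Context {R : realType} (p : nat) (alpha : 'I_p -> R) (n : 'I_p -> nat).
Local Notation index := {i : 'I_p & 'I_(n i)}.

(** A pair [(i, l)] stands for the monomial [x^l] of the [i]-th polynomial; the node is its exponent
    once the weight [x^alpha_i] is included. *)
Definition node (u : index) : R := alpha (tag u) + (tagged u)%:R.

Lemma card_index : #|{: index}| = msize n.
Proof.
rewrite card_tagged sumnE big_map /msize big_enum.
by apply: eq_bigr => i _; rewrite card_ord.
Qed.

Lemma node_inj : (forall i j, i != j -> alpha i - alpha j \isn't a Num.int) ->
  injective node.
Proof.
move=> hdiff [i l] [k m]; rewrite /node/= => uv.
have ik : i = k.
  apply/eqP/negP => /negP /hdiff/negP; apply.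
  rewrite (_ : _ - _ = m%:R - l%:R); last by lra.
  by rewrite rpredB ?rpred_nat.
case: k / ik m uv => m /addrI/eqP; rewrite eqr_nat => /eqP lm.
by congr existT; exact: val_inj.
Qed.

Lemma prod_index_neq (f : forall i, 'I_(n i) -> R) (u : index) :
  \prod_(v : index | v != u) f (tag v) (tagged v) =
  \prod_(m < n (tag u) | m != tagged u) f (tag u) m *
  \prod_(k < p | k != tag u) \prod_(m < n k) f k m.
Proof.
rewrite big_mkcond/=.
rewrite -(@sig_big_dep _ _ _ _ _ predT (fun _ => predT)
  (fun i (l : 'I_(n i)) => if (existT _ i l : index) != u then f i l else 1)) /=.
  rewrite (bigD1 (tag u))//= [in RHS]big_mkcond/=; congr (_ * _).
    case: u => i l /=; apply: eq_bigr => m _.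
    by rewrite -tag_eqE /tag_eq/= eqxx tagged_asE.
  apply: eq_bigr => k ki; apply: eq_bigr => m _; case: ifP => // /negbFE/eqP uE.
  by rewrite -uE eqxx in ki.
Qed.

Lemma sum_index (f : forall i, 'I_(n i) -> R) :
  \sum_(i < p) \sum_(l < n i) f i l = \sum_(u : index) f (tag u) (tagged u).
Proof. exact: (@sig_big_dep _ _ _ _ _ predT (fun _ => predT)). Qed.

End nodes.

(** * The coefficients of the type I polynomials and their hypergeometric form *)

Section coefficients.
Context {R : realType} (p : nat) (alpha : 'I_p -> R) (beta : R) (n : 'I_p -> nat).
Local Notation index := {i : 'I_p & 'I_(n i)}.
Local Notation N := (msize n).
Local Notation node := (@node R p alpha n).
Hypotheses (halpha : forall i, -1 < alpha i) (hbeta : -1 < beta).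
Hypothesis hdiff : forall i j, i != j -> alpha i - alpha j \isn't a Num.int.
Hypothesis hn : (0 < N)%N.

Let betaN_gt0 : 0 < beta + N%:R.
Proof. by rewrite -[0](addNr 1) ltr_leD// (ler_nat _ 1). Qed.

Let node1_gt0 u : 0 < node u + 1.
Proof. by rewrite -ltrBlDr sub0r ltr_wpDr. Qed.

Let node_betaN_gt0 u : 0 < node u + beta + N%:R + 1.
Proof.
rewrite (_ : _ + 1 = node u + 1 + (beta + N%:R)); last by ring.
exact: addr_gt0.
Qed.

(** This is the solution [d_z] of the interpolation problem: [Gamma (beta + 1)] and
    [(beta + 1)_(N-1)] have merged into [Gamma (beta + N)], and each Lagrange factor has the signs
    of its numerator and denominator reversed. *)
Definition typeI_coefficient (u : index) : R :=
  (-1) ^+ N.-1 *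
  (Gamma (node u + beta + N%:R + 1) / (Gamma (node u + 1) * Gamma (beta + N%:R))) *
  \prod_(v | v != u) ((node v + beta + N%:R) / (node v - node u)).

(** The Lagrange product splits by families of nodes. The family of [i] gives the factorials and the
    parameter [w]; the other families give [A / E], which the reflection formula turns into the
    remaining parameters. *)
Lemma typeI_hypergeom_coefficient (i : 'I_p) (l : 'I_(n i)) :
  typeI_coef alpha beta n i *
    ((\prod_(t <- typeI_upper alpha beta n i) poch t l) /
     (\prod_(t <- typeI_lower alpha i) poch t l) / (l`!)%:R) =
  typeI_coefficient (existT _ i l).
Proof.
have ln := ltn_ord l.
set a := alpha i; set w := a + beta + N%:R; set r := (n i - l.+1)%N.
have ai : -1 < a := halpha i.
have rE : (l + r)%N = (n i).-1 by rewrite /r; lia.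
have nE : (n i)%:R = l%:R + 1 + r%:R :> R by rewrite natr1 -natrD subnKC.
rewrite /typeI_coef /typeI_upper /typeI_lower /typeI_coefficient.
rewrite !big_cons !big_map !big_filter !big_enum_cond /=.
rewrite (@prod_index_neq R p n (fun k (m : 'I_(n k)) =>
  (alpha k + m%:R + beta + N%:R) / (alpha k + m%:R - node (existT _ i l)))) /=.
rewrite /node /=.
rewrite -/a -/w (_ : a + l%:R + beta + N%:R + 1 = w + l%:R + 1); last first.
  by rewrite /w; ring.
set A := \prod_(k < p | k != i) poch (_ + N%:R) _.
set B := \prod_(k < p | k != i) poch (alpha k - a) _.
set C := \prod_(k < p | k != i) poch (_ - _%:R) _.
set D := \prod_(k < p | k != i) poch (a + 1 - alpha k) _.
pose E := \prod_(k < p | k != i) poch (alpha k - a - l%:R) (n k).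
have a1_gt0 : 0 < a + 1 by rewrite -ltrBlDr sub0r.
(* Only [w > -1] is known, so Gamma is evaluated at [w + l + 1] and above. *)
have w_gt0 : 0 < w + l%:R + 1.
  rewrite (_ : _ + 1 = node (existT _ i l) + beta + N%:R + 1) //.
  by rewrite /w /node /= -/a; ring.
have d_nint k : k != i -> alpha k - a \isn't a Num.int by exact: hdiff.
have B0 : B != 0 by apply/prodf_neq0 => k /d_nint; exact: poch_neq0.
have D0 : D != 0.
  apply/prodf_neq0 => k ki; apply: poch_neq0; apply: contra (d_nint k ki) => h.
  rewrite (_ : _ - _ = 1 - (a + 1 - alpha k)); last by ring.
  by rewrite rpredB ?rpred1.
have E0 : E != 0.
  apply/prodf_neq0 => k ki; apply: poch_neq0; apply: contra (d_nint k ki) => h.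
  by rewrite -[_ - a](subrK l%:R) rpredD ?rpred_nat.
have CE : C = B * D / E.
  apply: (canRL (mulfK E0)); rewrite -!big_split /=; apply: eq_bigr => k _.
  rewrite (_ : a + 1 - alpha k = 1 - (alpha k - a)); last by ring.
  by rewrite poch_reflection.
have kE : \prod_(k < p | k != i) \prod_(m < n k)
    ((alpha k + m%:R + beta + N%:R) / (alpha k + m%:R - (a + l%:R))) = A / E.
  rewrite -prodf_div; apply: eq_bigr => k _; rewrite prodf_div.
  by congr (_ / _); apply: eq_bigr => m _; ring.
pose s : R := (-1) ^+ l.
have sV : s^-1 = s by rewrite /s invr_sign.
(* Omitting [m = l] drops the factor [w + l]: the factors below it form the Pochhammer symbol of
   [w], and those above it later extend [Gamma (w + l + 1)] to [Gamma (w + n_i)]. The sign [s] comes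
   from the negative differences [m - l]. *)
have iE : \prod_(m < n i | m != l)
    ((a + m%:R + beta + N%:R) / (a + m%:R - (a + l%:R))) =
    s * poch w l * poch (w + l%:R + 1) r / (l`!%:R * r`!%:R).
  rewrite (@prod_ord_neq _
    (fun m => (a + m%:R + beta + N%:R) / (a + m%:R - (a + l%:R)))) !prodf_div.
  transitivity (poch w l * poch (w + l%:R + 1) r / (s * l`!%:R * r`!%:R)); last first.
    by rewrite -[s * _ * _]mulrA invfM sV; ring.
  rewrite mulf_div -/r; congr (_ * _ / (_ * _)).
  - by apply: eq_bigr => m _; rewrite /w; ring.
  - by apply: eq_bigr => m _; rewrite /w natrD -natr1; ring.
  - rewrite -[l`!%:R](@poch_nat1 R) -[X in poch X](_ : l%:R - l%:R + 1 = _) -?pochN.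
      by apply: eq_bigr => m _; ring.
    by ring.
  - rewrite -poch_nat1; apply: eq_bigr => m _; rewrite natrD -natr1; ring.
have G1 : Gamma (w + (n i)%:R) = poch (w + l%:R + 1) r * Gamma (w + l%:R + 1).
  by rewrite (_ : w + _ = w + l%:R + 1 + r%:R) ?GammaD// nE; ring.
have G3 : Gamma (a + l%:R + 1) = poch (a + 1) l * Gamma (a + 1).
  by rewrite (_ : a + l%:R + 1 = a + 1 + l%:R); [exact: GammaD|ring].
have fE : inv_fact_pred (n i) = ((l + r)`!%:R)^-1 :> R.
  have invE m : (0 < m)%N -> inv_fact_pred m = (m.-1`!%:R)^-1 :> R by case: m.
  by rewrite rE; apply: invE; exact: leq_ltn_trans ln.
have qE : poch (1 - (n i)%:R) l = s * (l + r)`!%:R / r`!%:R.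
  apply: (canRL (mulfK _)); first by rewrite pnatr_eq0 -lt0n fact_gt0.
  rewrite (_ : 1 - (n i)%:R = - (l + r)%:R); last by rewrite nE natrD; ring.
  rewrite pochN -mulrA; congr (_ * _).
  rewrite (_ : _ - _ + 1 = 1 + r%:R); last by rewrite natrD; ring.
  by rewrite addnC -!poch_nat1 pochD mulrC.
rewrite kE iE G1 G3 fE qE CE.
have f0 m : m`!%:R != 0 :> R by rewrite pnatr_eq0 -lt0n fact_gt0.
have Ga0 : Gamma (a + 1) != 0 by rewrite gt_eqF// Gamma_gt0.
have Gb0 : Gamma (beta + N%:R) != 0 by rewrite gt_eqF// Gamma_gt0.
have p0 : poch (a + 1) l != 0 by rewrite gt_eqF// poch_gt0.
move: B0 D0 E0 Ga0 Gb0 p0 (f0 l) (f0 r) (f0 (l + r)%N); clearbody A B D E s.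
move: ((-1) ^+ _) (Gamma (w + l%:R + 1)) (Gamma (a + 1)) (Gamma (beta + _)).
move: (poch w l) (poch (w + l%:R + 1) r) (poch (a + 1) l).
move: (l`!%:R) (r`!%:R) ((l + r)`!%:R) => *.
by field; do !(apply/andP; split).
Qed.


(** Putting the Gamma quotients over the common denominator [Gamma (z + beta + N + 1)] moves all
    dependence on [j] into [moment_poly]. *)
Lemma sum_jacobi_moment (P : 'I_p -> {poly R}) j :
  (forall i, (size (P i) <= n i)%N) -> (j < N)%N ->
  (\sum_(i < p) jacobi_moment beta (alpha i) (P i) j)%E =
  (\sum_(u : index) (P (tag u))`_(tagged u) *
     (Gamma (node u + 1) * Gamma (beta + 1) / Gamma (node u + beta + N%:R + 1)) *
     (moment_poly beta N j).[node u])%:E.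
Proof.
move=> sP jN.
under eq_bigr do rewrite (jacobi_momentE _ _ _ _ _ (halpha _) hbeta (sP _)).
rewrite sumEFin; congr (_%:E).
rewrite (@sum_index R p n (fun i l => (P i)`_l * (Gamma (alpha i + l%:R + j%:R + 1) *
  Gamma (beta + 1) / Gamma (alpha i + l%:R + j%:R + beta + 2)))).
apply: eq_bigr => u _; rewrite -[alpha _ + (tagged u)%:R]/(node u).
have z2 : 0 < node u + beta + j%:R + 2.
  rewrite (_ : _ + 2 = node u + 1 + (beta + 1) + j%:R); last by ring.
  by rewrite ltr_wpDr// addr_gt0// -ltrBlDr sub0r.
rewrite horner_moment_poly.
rewrite (_ : node u + j%:R + 1 = node u + 1 + j%:R); last by ring.
rewrite (_ : node u + j%:R + beta + 2 = node u + beta + j%:R + 2); last by ring.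
rewrite (_ : node u + beta + N%:R + 1 =
    node u + beta + j%:R + 2 + (N - j.+1)%:R); last by rewrite natrB// -natr1; ring.
rewrite (GammaD (node u + 1))// (GammaD (_ + 2))//.
have := Gamma_gt0 _ z2; have := poch_gt0 _ (N - j.+1)%N z2.
move: (Gamma (node u + 1)) (Gamma (beta + 1)) (Gamma (node u + beta + _ + _)).
move: (poch _ j) (poch _ (N - j.+1)) => p1 p2 g1 g2 g3 p20 g30.
move: (_`_ _) => c.
by field; rewrite (gt_eqF p20) (gt_eqF g30).
Qed.

Lemma is_typeI_coefficients (P : 'I_p -> {poly R}) :
  is_typeI alpha beta n P <->
  (forall i, (size (P i) <= n i)%N) /\
  (forall u : index, (P (tag u))`_(tagged u) = typeI_coefficient u).
Proof.
(* This factor is nonzero and independent of [j], so the coefficients of [P] and the unknowns [e] of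
   the linear system determine each other. *)
pose g (u : index) : R :=
  Gamma (node u + 1) * Gamma (beta + 1) / Gamma (node u + beta + N%:R + 1).
pose e (u : index) : R := (P (tag u))`_(tagged u) * g u.
have cN := card_index p n.
have := @moment_system R beta index node e (@node_inj R p alpha n hdiff) hbeta.
rewrite cN => /(_ hn) sys.
have b1 : 0 < beta + 1 by rewrite -ltrBlDr sub0r.
have g0 u : g u != 0.
  by rewrite gt_eqF// divr_gt0 ?mulr_gt0 ?Gamma_gt0.
have gE u : typeI_coefficient u * g u = ((-1) ^+ N.-1 * poch (beta + 1) N.-1)^-1 *
    \prod_(v | v != u) ((- (beta + N%:R) - node v) / (node u - node v)).
  rewrite /typeI_coefficient /g.
  rewrite (eq_bigr (fun v => (- (beta + N%:R) - node v) / (node u - node v))).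
    rewrite (_ : Gamma (beta + N%:R) = Gamma (beta + 1 + N.-1%:R)); last first.
      by congr Gamma; rewrite -[in LHS](prednK hn) -natr1; ring.
    rewrite (GammaD (beta + 1))// [in RHS]invfM invr_sign; have := Gamma_gt0 _ b1.
    have := Gamma_gt0 _ (node1_gt0 u); have := Gamma_gt0 _ (node_betaN_gt0 u).
    have := poch_gt0 _ N.-1 b1.
    move: (\prod_(v : index | v != u) _) ((-1) ^+ _) => x s.
    move: (Gamma (_ + N%:R + 1)) (Gamma (beta + 1)) (Gamma (node u + 1)) (poch _ _).
    move=> g1 g2 g3 q q0 g10 g30 g20; field.
    by rewrite (gt_eqF q0) (gt_eqF g10) (gt_eqF g20) (gt_eqF g30).
  by move=> v _; rewrite -mulrNN -invrN; congr (_ / _); ring.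
split=> [[sP mom0 mom1]|[sP coefE]].
  split=> // u; apply: (mulIf (g0 u)); rewrite gE; apply: sys.1 => j jN.
  have := sum_jacobi_moment P j sP jN.
  case: eqVneq => [->|jN1]; first by rewrite mom1 => -[<-].
  by rewrite mom0 => [[<-]//|]; move: jN jN1 => /[swap]/eqP; lia.
have mom j : (j < N)%N ->
    (\sum_(i < p) jacobi_moment beta (alpha i) (P i) j)%E = ((j == N.-1)%:R)%:E.
  move=> jN; rewrite sum_jacobi_moment//; congr (_%:E); apply: sys.2 => // u.
  by rewrite /e coefE gE.
split=> // [j jN|]; rewrite mom ?eqxx//; first by case: eqP => //; lia.
  lia.
by rewrite prednK.
Qed.

Definition typeI_poly (i : 'I_p) : {poly R} := \poly_(l < n i)
  (typeI_coef alpha beta n i *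
    ((\prod_(t <- typeI_upper alpha beta n i) poch t l) /
     (\prod_(t <- typeI_lower alpha i) poch t l) / (l`!)%:R)).

Lemma horner_typeI_poly i x : (typeI_poly i).[x] = typeI_coef alpha beta n i *
  hypergeom (typeI_upper alpha beta n i) (typeI_lower alpha i) x.
Proof.
(* For [n_i = 0] the upper parameter [1 - n_i] is 1 and does not terminate the series, but
   [inv_fact_pred] makes the prefactor 0 whatever the limit is. *)
have [ni0|ni0] := posnP (n i).
  rewrite /typeI_poly /typeI_coef ni0 /= !(mulr0, mul0r).
  by rewrite horner_poly big_ord0.
rewrite (hypergeom_terminating _ _ _ (n i)) => [|l nl]; last first.
  rewrite big_cons (_ : 1 - (n i)%:R = - (n i).-1%:R); last first.
    by rewrite -[in LHS](prednK ni0) -natr1; ring.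
  by rewrite poch_neg_nat0 ?mul0r// prednK.
rewrite horner_poly mulr_sumr; apply: eq_bigr => l _.
by rewrite -[LHS]mulrA [_ / _ * x ^+ l]mulrAC -mulrA.
Qed.

Lemma is_typeI_poly (P : 'I_p -> {poly R}) :
  is_typeI alpha beta n P <-> P =1 typeI_poly.
Proof.
split=> [/is_typeI_coefficients[sP coefE] i|PE].
  apply/polyP => l; rewrite coef_poly; case: ltnP => [ln|nl].
    by rewrite (typeI_hypergeom_coefficient i (Ordinal ln)) -coefE.
  by rewrite nth_default// (leq_trans (sP i)).
apply/is_typeI_coefficients; split=> [i|[i l]]; first by rewrite PE size_poly.
by rewrite PE coef_poly ltn_ord typeI_hypergeom_coefficient.
Qed.

End coefficients.

(** In characteristic zero the naturals supply more distinct roots of [f - g] than its degree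
    allows. This turns the pointwise formula into an equality of polynomials. *)
Lemma horner_inj (F : numDomainType) (f g : {poly F}) :
  (forall x, f.[x] = g.[x]) -> f = g.
Proof.
move=> fg; apply/eqP; rewrite -subr_eq0; apply/eqP.
apply: (@roots_geq_poly_eq0 _ _ [seq k%:R | k <- iota 0 (size (f - g))]).
- by apply/allP => _ /mapP[k _ ->]; rewrite rootE hornerD hornerN fg subrr.
- by rewrite map_inj_uniq ?iota_uniq//; exact: mulrIn (oner_neq0 _).
- by rewrite size_map size_iota.
Qed.

Theorem theorem2 (R : realType) (p : nat) (alpha : 'I_p -> R) (beta : R)
    (n : 'I_p -> nat) (P : 'I_p -> {poly R})
    (hp : (2 <= p)%N)
    (halpha : forall i : 'I_p, -1 < alpha i)
    (hbeta : -1 < beta)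
    (hdiff : forall i j : 'I_p, i != j -> alpha i - alpha j \isn't a Num.int)
    (hn : (1 <= \sum_(i < p) n i)%N) :
  is_typeI alpha beta n P <->
  (forall (i : 'I_p) (x : R),
     (P i).[x] = typeI_coef alpha beta n i *
                 hypergeom (typeI_upper alpha beta n i) (typeI_lower alpha i) x).
Proof.
rewrite is_typeI_poly//; split=> [PE i x|PE i].
  by rewrite PE horner_typeI_poly.
by apply: horner_inj => x; rewrite PE horner_typeI_poly.
Qed.
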